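(* Let $d\ge1$ be a constant and $K\ge1$. There is a constant $C$ such that every $d$-dimensional torus graph $G$ with $n$ vertices satisfies $\widetilde{\mathsf{EC}}(G)\le C n^{1+1/d}$ for every choice of rotor sequence lengths with $\tilde\kappa\le K$.
   Context: The $d$-dimensional torus with $n$ vertices is the Cartesian product of $d$ cycles each of length $n^{1/d}$. Unweighted deterministic walk: each vertex $u$ has a rotor sequence of length $\tilde d(u)$ of neighbours of $u$, each occurring exactly $\tilde d(u)/\deg(u)$ times, and an initial rotor position; $\tilde\kappa=\max_u\tilde d(u)/\deg(u)$. The walk moves from the current vertex to the vertex its rotor points at and then advances that rotor cyclically. $\widetilde{\mathsf{EC}}(G)$ is the maximum over start vertices and all rotor sequences/initial positions (lengths fixed) of the first time every edge has been traversed. (The paper states its bounds for specific graphs under the standing assumption $\tilde\kappa=O(1)$.) *)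

(* Defs.v *)
From mathcomp Require Import all_boot all_order all_algebra.
From mathcomp Require Import all_classical all_reals all_analysis.

Set Implicit Arguments.
Unset Strict Implicit.
Unset Printing Implicit Defensive.

Import Order.TTheory GRing.Theory Num.Theory.
Import numFieldNormedType.Exports.

Local Open Scope classical_set_scope.
Local Open Scope ring_scope.

Definition cycle_adj (m : nat) : rel 'I_m :=
  fun i j => (j == ordS i) || (i == ordS j).

Definition cartesian_adj (I : finType) (V : eqType) (e : I -> rel V) :
    rel {ffun I -> V} :=
  fun u v => [exists i, e i (u i) (v i) && [forall j, (j != i) ==> (u j == v j)]].

(* A vertex of the torus is its tuple of [d] coordinates, so the number of
   vertices is n = m ^ d and the side length is m = n ^ (1/d). *)
Definition torus (d m : nat) : finType := {ffun 'I_d -> 'I_m}.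

Definition torus_adj (d m : nat) : rel (torus d m) :=
  cartesian_adj (fun _ : 'I_d => @cycle_adj m).

Section DeterministicWalk.
Variables (V : finType) (e : rel V).

Definition deg (u : V) : nat := #|e u|.

(* The divisibility makes [td u / deg u] an integer; the positivity says that
   every vertex has a rotor to follow. *)
Definition rotor_lengths (td : V -> nat) : Prop :=
  forall u, (0 < td u)%N /\ (deg u %| td u)%N.

(* The quotients are exact for [td] satisfying [rotor_lengths]. *)
Definition kappa (td : V -> nat) : nat := (\max_(u : V) (td u %/ deg u))%N.

Definition rotor_sequences (td : V -> nat) (s : V -> seq V) : Prop :=
  forall u, [/\ size (s u) = td u,
    forall v, v \in s u -> e u v &
    forall v, e u v -> count_mem v (s u) = (td u %/ deg u)%N].

Definition rotor_positions (td p : V -> nat) : Prop :=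
  forall u, (p u < td u)%N.

(* A state is the current vertex with the positions of all the rotors. *)
Definition walk_step (s : V -> seq V) (st : V * (V -> nat)) : V * (V -> nat) :=
  let: (x, p) := st in
  (nth x (s x) (p x),
   fun u => if u == x then ((p u).+1 %% size (s u))%N else p u).

Definition walk (s : V -> seq V) (p : V -> nat) (x : V) (t : nat) : V :=
  (iter t (walk_step s) (x, p)).1.

(* Edges are undirected: traversing one in either direction counts. *)
Definition edges_traversed (s : V -> seq V) (p : V -> nat) (x : V) (T : nat) :
    Prop :=
  forall u v, e u v -> exists t, (t < T)%N /\
    let a := walk s p x t in let b := walk s p x t.+1 in
    (a = u /\ b = v) \/ (a = v /\ b = u).

(* The value is [+oo] if some edge is never traversed. *)
Definition first_cover_time (R : realType) (s : V -> seq V) (p : V -> nat)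
    (x : V) : \bar R :=
  ereal_inf [set (T%:R : R)%:E | T in edges_traversed s p x].

Definition edge_cover_time (R : realType) (td : V -> nat) : \bar R :=
  ereal_sup [set c : \bar R | exists s p x,
    [/\ rotor_sequences td s, rotor_positions td p &
        c = first_cover_time R s p x]].

End DeterministicWalk.

(* Main.v *)
(** Let [L] be a common multiple of the integers [td u / deg u]; since these are
at most [K], one may take the factorial of the integer part of [K]. Whatever the
rotor positions, [L * deg u] departures from [u] traverse each arc out of [u]
exactly [L] times. Cut the walk into phases, each ending when the starting vertex
[x] is about to exceed [L * deg x] departures. By conservation of flow no other
vertex exceeds its quota first, so a phase returns to [x] and lasts at most
[L * \sum_u deg u] steps. Call a vertex saturated if it uses its whole quota. All
the neighbours of a saturated vertex are visited in the same phase, and a vertex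
visited in one phase is saturated in the next one: follow the tree of last
exits, rooted at [x]. Hence after as many phases as the eccentricity of [x], plus
one, all vertices are saturated and all arcs have been traversed. *)
Require Import Defs.
From mathcomp Require Import all_boot all_order all_algebra.
From mathcomp Require Import all_classical all_reals all_analysis.
From mathcomp Require Import zify.

Set Implicit Arguments.
Unset Strict Implicit.
Unset Printing Implicit Defensive.

Import Order.TTheory GRing.Theory Num.Theory.
Import numFieldNormedType.Exports.

Local Open Scope classical_set_scope.
Local Open Scope ring_scope.

(** * Sums over whole periods *)

Lemma sum_periodic (n : nat) (h : nat -> nat) (p q : nat) :
  (forall i, h (i + n)%N = h i) ->
  (\sum_(i < q * n) h (p + i) = q * \sum_(i < n) h i)%N.
Proof.
move=> hn.
have shift a : (\sum_(i < n) h (a + i) = \sum_(i < n) h i)%N.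
  elim: a => [|a IHa]; first exact: eq_bigr.
  (* Completed by [h a], both windows become the same sum of [n.+1] consecutive values. *)
  rewrite -IHa; apply: (@addnI (h a)).
  transitivity (\sum_(i < n.+1) h (a + i))%N.
    rewrite big_ord_recl addn0; congr (_ + _)%N.
    by apply: eq_bigr => i _; rewrite lift0 addSnnS.
  by rewrite big_ord_recr /= hn addnC.
elim: q p => [|q IHq] p; first by rewrite big_ord0.
rewrite mulSn big_split_ord /= shift mulSn; congr (_ + _)%N.
by rewrite -(IHq (p + n)%N); apply: eq_bigr => i _; rewrite addnA.
Qed.

(** * Rotor counts and conservation of flow *)

Section Phases.
Variables (V : finType) (e : rel V) (td : V -> nat) (s : V -> seq V) (L : nat).
Hypothesis e_sym : symmetric e.
Hypothesis td_ok : rotor_lengths e td.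
Hypothesis s_ok : rotor_sequences e td s.
Hypothesis L_gt0 : (0 < L)%N.
Hypothesis kappa_L : forall u, (td u %/ deg e u %| L)%N.

Implicit Types (p : V -> nat) (u v w x : V) (t k : nat).

Let quota u : nat := (L * deg e u)%N.

Definition rotor p x t : V -> nat := (iter t (walk_step s) (x, p)).2.

Definition visits p x t u : nat := (\sum_(i < t) (walk s p x i == u))%N.

Definition crossings p x t u v : nat :=
  (\sum_(i < t) ((walk s p x i == u) && (walk s p x i.+1 == v)))%N.

Definition exits p u v k : nat :=
  (\sum_(i < k) (nth u (s u) ((p u + i) %% td u) == v))%N.

Lemma walkD p x t0 t :
  walk s p x (t0 + t) = walk s (rotor p x t0) (walk s p x t0) t.
Proof. by rewrite /walk /rotor addnC iterD -surjective_pairing. Qed.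

Lemma rotorD p x t0 t :
  rotor p x (t0 + t) = rotor (rotor p x t0) (walk s p x t0) t.
Proof. by rewrite /walk /rotor addnC iterD -surjective_pairing. Qed.

Lemma walkS p x t :
  walk s p x t.+1 =
  nth (walk s p x t) (s (walk s p x t)) (rotor p x t (walk s p x t)).
Proof. by rewrite /walk /rotor iterS; case: (iter t _ _). Qed.

Lemma visitsS p x t u :
  visits p x t.+1 u = (visits p x t u + (walk s p x t == u))%N.
Proof. by rewrite /visits big_ord_recr. Qed.

Lemma exitsS p u v k :
  exits p u v k.+1 =
  (exits p u v k + (nth u (s u) ((p u + k) %% td u) == v))%N.
Proof. by rewrite /exits big_ord_recr. Qed.

Lemma td_gt0 u : (0 < td u)%N. Proof. by have [] := td_ok u. Qed.

Lemma deg_gt0 u : (0 < deg e u)%N.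
Proof. by have [td0 dtd] := td_ok u; apply: dvdn_gt0 dtd. Qed.

Lemma quota_gt0 u : (0 < quota u)%N. Proof. by rewrite muln_gt0 L_gt0 deg_gt0. Qed.

Lemma quotaE u : quota u = (L %/ (td u %/ deg e u) * td u)%N.
Proof.
have [_ dtd] := td_ok u.
by rewrite -{2}(divnK dtd) mulnA divnK.
Qed.

Lemma size_s u : size (s u) = td u. Proof. by have [] := s_ok u. Qed.

Lemma rotorE p x t u : rotor_positions td p ->
  rotor p x t u = ((p u + visits p x t u) %% td u)%N.
Proof.
move=> p_ok; elim: t => [|t IHt].
  by rewrite /visits big_ord0 addn0 modn_small ?p_ok.
rewrite visitsS addnA -modnDml -IHt /rotor iterS /walk.
have lt_r : (rotor p x t u < td u)%N by rewrite IHt ltn_mod td_gt0.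
move: lt_r; rewrite /rotor; case: (iter t _ _) => y r /= lt_r.
by rewrite eq_sym; case: eqP => [<-|_] /=; rewrite ?size_s ?addn1 // addn0 modn_small.
Qed.

Lemma rotor_ok p x t : rotor_positions td p -> rotor_positions td (rotor p x t).
Proof. by move=> p_ok u; rewrite rotorE // ltn_mod td_gt0. Qed.

(** The rotor of [u] moves only when the walk leaves [u], so successive departures read successive
    entries. *)
Lemma crossingsE p x t u v : rotor_positions td p ->
  crossings p x t u v = exits p u v (visits p x t u).
Proof.
move=> p_ok; elim: t => [|t IHt].
  by rewrite /crossings /visits /exits !big_ord0.
rewrite visitsS /crossings big_ord_recr /= -/(crossings _ _ _ _ _) IHt walkS.
case: eqP => [->|_] /=; last by rewrite !addn0.
by rewrite addn1 exitsS rotorE.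
Qed.

Lemma sum_visits p x t : (\sum_u visits p x t u = t)%N.
Proof.
rewrite /visits exchange_big /= (eq_bigr (fun=> 1%N)) ?sum1_card ?card_ord //.
by move=> i _; rewrite (bigD1 (walk s p x i)) //= eqxx big1 // => u;
  rewrite eq_sym => /negPf ->.
Qed.

(** The times [0] to [t] spent at [u] are counted twice: all but time [0] are arrivals, all but time
    [t] are departures. *)
Lemma flow p x t u :
  (\sum_w crossings p x t w u + (x == u) = visits p x t u + (walk s p x t == u))%N.
Proof.
have -> : (\sum_w crossings p x t w u = \sum_(i < t) (walk s p x i.+1 == u))%N.
  rewrite /crossings exchange_big /=; apply: eq_bigr => i _.
  rewrite (bigD1 (walk s p x i)) //= eqxx big1 ?addn0 // => w.
  by rewrite eq_sym => /negPf ->.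
by rewrite -visitsS /visits big_ord_recl addnC.
Qed.

Lemma exits_nonadj p u v k : ~~ e u v -> exits p u v k = 0%N.
Proof.
move=> nuv; rewrite /exits big1 // => i _; case: eqP => // uv.
have [sz sub _] := s_ok u; case/negP: nuv; apply: sub.
by rewrite -uv mem_nth // sz ltn_mod td_gt0.
Qed.

(** The quota is a whole number of turns of the rotor, each with [td u %/ deg e u] exits to [v]. *)
Lemma exits_quota p u v : e u v -> exits p u v (quota u) = L.
Proof.
move=> uv; rewrite quotaE /exits.
rewrite (@sum_periodic _ (fun i => (nth u (s u) (i %% td u) == v) : nat)); last first.
  by move=> i; rewrite modnDr.
have [sz _ cnt] := s_ok u.
have -> : (\sum_(i < td u) (nth u (s u) (i %% td u) == v) = count_mem v (s u))%N.
  rewrite -sum1_count [RHS]big_mkcond (big_nth u) big_mkord sz.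
  by apply: eq_bigr => i _; rewrite modn_small //= ; case: eqP.
by rewrite cnt // divnK.
Qed.

Lemma leq_exits p u v k1 k2 : (k1 <= k2)%N -> (exits p u v k1 <= exits p u v k2)%N.
Proof.
move=> /subnK <-; elim: (k2 - k1)%N => // k IHk.
by rewrite addSn exitsS; apply: leq_trans IHk (leq_addr _ _).
Qed.

Lemma exits_leq p u v k : (k <= quota u)%N -> (exits p u v k <= L * e u v)%N.
Proof.
case uv: (e u v) => le_k; first by rewrite muln1 -(exits_quota p uv) leq_exits.
by rewrite exits_nonadj ?uv.
Qed.

(** By symmetry as many arcs enter [u] as leave it, so the quota also caps arrivals. *)
Lemma sum_adj u : (\sum_w L * e w u = quota u)%N.
Proof.
rewrite -big_distrr /=; congr (_ * _)%N; rewrite /deg -sum1_card [RHS]big_mkcond.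
by apply: eq_bigr => w _; rewrite e_sym -topredE /=; case: (e u w).
Qed.

(** * Phases and saturated vertices *)

Definition phase p x t : Prop :=
  [/\ walk s p x t = x, forall u, (visits p x t u <= quota u)%N
    & visits p x t x = quota x].

Definition saturated p x t u : Prop := visits p x t u = quota u.

(* The first vertex to use up its quota must be the origin: the other quotas
   let at most [quota u] arrivals into [u]. *)
Lemma phase_exists p x : rotor_positions td p ->
  exists2 t, (t <= \sum_u quota u)%N & phase p x t.
Proof.
move=> p_ok.
pose full t := (quota (walk s p x t) <= visits p x t (walk s p x t))%N.
have below t : (forall i, (i < t)%N -> ~~ full i) ->
    forall u, (visits p x t u <= quota u)%N.
  elim: t => [|t IHt] nf u; first by rewrite /visits big_ord0.
  rewrite visitsS; have := nf t (ltnSn t); rewrite /full -ltnNge.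
  case: eqP => [->|_ _]; first by rewrite addn1.
  by rewrite addn0; apply: IHt => i lt_it; apply/nf/ltnW.
have full_ex : exists t, full t.
  (* Otherwise all vertices would stay within quota after more steps than the quotas sum to. *)
  apply: contrapT => nf.
  have := sum_visits p x (\sum_u quota u).+1 => sv.
  suff : ((\sum_u quota u).+1 <= \sum_u quota u)%N by rewrite ltnn.
  rewrite -{1}sv; apply: leq_sum => u _; apply: below => i _.
  by apply/negP => fi; apply: nf; exists i.
have [t ft min_t] := ex_minnP full_ex.
have le_q u : (visits p x t u <= quota u)%N.
  by apply: below => i; rewrite ltnNge; apply: contra; apply: min_t.
exists t.
  by rewrite -{1}(sum_visits p x t); apply: leq_sum.
have vt : visits p x t (walk s p x t) = quota (walk s p x t).
  by apply/eqP; rewrite eqn_leq le_q.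
suff wx : walk s p x t = x by split; rewrite // -{3}wx -vt wx.
(* Departures equal the quota and the walk is there once more, while arrivals are at most the quota:
   only the start at [x] supplies the missing one. *)
have := flow p x t (walk s p x t); rewrite vt eqxx.
have : (\sum_w crossings p x t w (walk s p x t) <= quota (walk s p x t))%N.
  rewrite -sum_adj; apply: leq_sum => w _.
  by rewrite crossingsE // exits_leq.
by case: eqP => [<- //|_]; lia.
Qed.

(** The walk is back at [x], so arrivals at [u] equal its departures, [quota u]. This is the sum of
    the caps [L] on the arcs into [u], hence each cap is attained. *)
Lemma saturated_crossings p x t u w : rotor_positions td p -> phase p x t ->
  saturated p x t u -> e w u -> crossings p x t w u = L.
Proof.
move=> p_ok [wt le_q _] su wu.
have := flow p x t u; rewrite wt su -sum_adj => /addIn.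
have le_c v : (crossings p x t v u <= L * e v u)%N by rewrite crossingsE // exits_leq.
rewrite (bigD1 w) // [RHS](bigD1 w) //= wu muln1 => eq_sum.
have := le_c w; rewrite wu muln1.
have : (\sum_(i | i != w) crossings p x t i u <= \sum_(i | i != w) L * e i u)%N.
  exact: leq_sum.
lia.
Qed.

Lemma crossings_visits p x t u v : (crossings p x t u v <= visits p x t u)%N.
Proof. by apply: leq_sum => i _; case: eqP => //= _; case: eqP. Qed.

Lemma crossing_adj p x t : rotor_positions td p ->
  e (walk s p x t) (walk s p x t.+1).
Proof.
move=> p_ok; rewrite walkS; have [sz sub _] := s_ok (walk s p x t).
by apply: sub; rewrite mem_nth // sz rotor_ok.
Qed.

(* The rotor of [u] starts the next phase just past an arc to a vertex [v]; hence
   that arc is its last one, and [u] crosses to [v] [L] times only if it uses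
   up its whole quota. *)
Lemma saturated_last_exit p x t u v : rotor_positions td p -> phase p x t ->
  saturated p x t v -> e u v ->
  nth u (s u) ((p u + (td u).-1) %% td u) = v -> saturated p x t u.
Proof.
move=> p_ok ph sv uv last_v.
have := saturated_crossings p_ok ph sv uv; rewrite crossingsE // => exL.
have [_ le_q _] := ph; apply/eqP; rewrite eqn_leq le_q /= leqNgt; apply/negP => lt_q.
have := exits_quota p uv; rewrite -(ltn_predK lt_q) exitsS.
(* [quota u] is a positive multiple of [td u], so its last departure reads the last entry of a
   turn. *)
have -> : ((p u + (quota u).-1) %% td u = (p u + (td u).-1) %% td u)%N.
  have := quota_gt0 u; rewrite quotaE; case: (L %/ _)%N => // q _.
  have -> : ((q.+1 * td u).-1 = (td u).-1 + q * td u)%N by have := td_gt0 u; lia.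
  by rewrite addnA addnC modnMDl.
rewrite last_v eqxx.
have : (exits p u v (visits p x t u) <= exits p u v (quota u).-1)%N.
  by apply: leq_exits; rewrite -ltnS (ltn_predK lt_q).
by rewrite exL; lia.
Qed.

Lemma visits_last_exit p x t i u : (i < t)%N -> walk s p x i = u ->
  (forall j, (i < j < t)%N -> walk s p x j != u) ->
  visits p x t u = (visits p x i u).+1.
Proof.
move=> lt_it wi no_u.
suff after k : (i.+1 + k <= t)%N -> visits p x (i.+1 + k) u = (visits p x i u).+1.
  by rewrite -(after (t - i.+1)%N) subnKC.
elim: k => [|k IHk] le_k; first by rewrite addn0 visitsS wi eqxx addn1.
rewrite addnS visitsS IHk ?(negPf (no_u _ _)) ?addn0 //; lia.
Qed.

(** Downward induction on time in the first phase: it ends at [x], which is saturated, and a last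
    exit leads to a vertex occupied later, hence already known to be saturated. *)
Lemma visited_saturated p x t t' u : rotor_positions td p ->
  phase p x t -> phase (rotor p x t) x t' ->
  (0 < visits p x t u)%N -> saturated (rotor p x t) x t' u.
Proof.
move=> p_ok [wt _ _] ph' vu.
have p'_ok : rotor_positions td (rotor p x t) by apply: rotor_ok.
have main k i : (t <= i + k)%N -> (i <= t)%N ->
    saturated (rotor p x t) x t' (walk s p x i).
  elim: k i => [|k IHk] i le_t le_i.
    have -> : i = t by lia.
    by rewrite wt; case: ph'.
  have [->|lt_it] : i = t \/ (i < t)%N by lia.
    by rewrite wt; case: ph'.
  (* A later visit to the same vertex is covered by induction; otherwise [i] is its last exit. *)
  have [/existsP[j /andP[lt_ij /eqP <-]]|/existsPn no_j] :=
      boolP [exists j : 'I_t, (i < j)%N && (walk s p x j == walk s p x i)].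
    by apply: IHk; [lia|exact/ltnW].
  apply: (saturated_last_exit p'_ok ph' (IHk i.+1 _ _)); try lia.
    exact: crossing_adj.
  rewrite walkS !rotorE // (@visits_last_exit _ _ _ i) //; last first.
    move=> j /andP[lt_ij lt_jt].
    by have := no_j (Ordinal lt_jt); rewrite /= lt_ij.
  (* The rotor stands one past the entry read at time [i]; the remaining steps complete a full
     turn. *)
  rewrite modnDml addnS addSnnS prednK ?td_gt0 // modnDr.
  by apply: set_nth_default; rewrite size_s ltn_mod td_gt0.
have [/existsP[i /eqP <-]|/existsPn nu] :=
    boolP [exists i : 'I_t, walk s p x i == u].
  by apply: (main t); [rewrite leq_addl|exact/ltnW].
by move: vu; rewrite /visits big1 // => i _; rewrite (negPf (nu i)).
Qed.

(** The arc points from the new vertex [u] to the ball, because saturation of [v] forces crossings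
    from [u] to [v]. *)
Fixpoint ball x k u : bool :=
  if k is k'.+1 then ball x k' u || [exists v, ball x k' v && e u v] else u == x.

(** [T] is the end of [k] phases and [t] the length of the next; each phase gains one unit of
    radius. *)
Lemma saturated_ball p x k : rotor_positions td p ->
  exists T t, [/\ (T <= k * \sum_u quota u)%N, (t <= \sum_u quota u)%N,
    walk s p x T = x, phase (rotor p x T) x t &
    forall u, ball x k u -> saturated (rotor p x T) x t u].
Proof.
move=> p_ok; elim: k => [|k [T [t [le_T le_t wT ph sat]]]].
  have [t le_t ph] := phase_exists x p_ok.
  by exists 0%N, t; split=> // u /= /eqP ->; case: ph.
set p1 := rotor p x T in ph sat.
have p1_ok : rotor_positions td p1 by apply: rotor_ok.
have rT : rotor p x (T + t) = rotor p1 x t.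
  by rewrite rotorD wT.
have [t' le_t' ph'] := phase_exists x (rotor_ok x t p1_ok).
exists (T + t)%N, t'; split=> //; rewrite ?rT //.
- by rewrite mulSn addnC leq_add.
- by rewrite walkD wT; case: ph.
move=> u /= ball_u; apply: (visited_saturated p1_ok ph ph').
case/orP: ball_u => [/sat ->|/existsP[v /andP[/sat sat_v uv]]].
  exact: quota_gt0.
apply: leq_trans (crossings_visits p1 x t u v).
by rewrite (saturated_crossings p1_ok ph sat_v uv).
Qed.

(** In the last of [k.+1] phases every arc has a saturated head, so it is crossed [L > 0] times. *)
Lemma edges_traversed_ball p x k : rotor_positions td p ->
  (forall u, ball x k u) -> edges_traversed e s p x (k.+1 * \sum_u quota u).
Proof.
move=> p_ok ball_all u v uv.
have [T [t [le_T le_t wT ph sat]]] := saturated_ball x k p_ok.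
have := saturated_crossings (rotor_ok x T p_ok) ph (sat v (ball_all v)) uv.
have [/existsP[i /andP[/eqP wi /eqP wi1]] _|/existsPn no_i cr0] :=
    boolP [exists i : 'I_t, (walk s (rotor p x T) x i == u)
                         && (walk s (rotor p x T) x i.+1 == v)].
  exists (T + i)%N; split; first by have := ltn_ord i; lia.
  by left; rewrite -addnS !walkD wT wi wi1.
by move: L_gt0; rewrite -cr0 /crossings big1 // => i _; rewrite (negPf (no_i i)).
Qed.

End Phases.

(** * Degrees and distances in the torus *)

Lemma cycle_adj_sym m : symmetric (@cycle_adj m).
Proof. by move=> i j; rewrite /cycle_adj orbC. Qed.

Lemma torus_adj_sym d m : symmetric (@torus_adj d m).
Proof.
move=> u v; rewrite /torus_adj /cartesian_adj; apply: eq_existsb => i.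
by rewrite cycle_adj_sym; congr (_ && _); apply: eq_forallb => j; rewrite (eq_sym (u j)).
Qed.

Definition coord_move d m (u : torus d m) (f : 'I_m -> 'I_m) (i : 'I_d) :
  torus d m := [ffun j => if j == i then f (u i) else u j].

(** A neighbour is determined by a coordinate and one of two directions. *)
Lemma deg_torus d m (u : torus d m) : (deg (@torus_adj d m) u <= d * 2)%N.
Proof.
pose f (ib : 'I_d * bool) :=
  coord_move u (if ib.2 then @ordS m else @ord_pred m) ib.1.
have <- : #|{: 'I_d * bool}| = (d * 2)%N by rewrite card_prod card_ord card_bool.
apply: leq_trans (leq_image_card f predT); apply/subset_leq_card/fintype.subsetP => v.
rewrite -topredE /= => /existsP[i /andP[uv /forallP eq_uv]].
have [b vi] : exists b : bool, v i = (if b then @ordS m else @ord_pred m) (u i).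
  by case/orP: uv => /eqP ->; [exists true|exists false; rewrite ordSK].
apply/fintype.imageP; exists (i, b) => //; apply/ffunP => j; rewrite ffunE /=.
by case: eqVneq => [->|ji] //; have := eq_uv j; rewrite ji => /eqP.
Qed.

(** Number of [ordS] moves from [u] to [x], in one direction only: an upper bound on the graph
    distance. Adding [m] avoids truncated subtraction. *)
Definition torus_dist d m (x u : torus d m) : nat :=
  (\sum_i (x i + m - u i) %% m)%N.

Lemma cycle_dist0 (a b m : nat) : (a < m)%N -> (b < m)%N ->
  ((a + m - b) %% m = 0)%N -> b = a.
Proof.
move=> lt_a lt_b; have [le_ba|lt_ab] := leqP b a.
  by rewrite -addnBAC // modnDr modn_small; lia.
by rewrite modn_small; lia.
Qed.

Lemma cycle_distS (a b m : nat) : (a < m)%N -> (b < m)%N ->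
  (0 < (a + m - b) %% m)%N ->
  ((a + m - b.+1 %% m) %% m < (a + m - b) %% m)%N.
Proof.
move=> lt_a lt_b ab_gt0; have [lt_b1|le_b1] := ltnP b.+1 m.
  move: ab_gt0; rewrite (modn_small lt_b1).
  have -> : (a + m - b = (a + m - b.+1).+1)%N by lia.
  by rewrite modnS; case: ifP.
(* Wrap-around: [b] moves to [0], and the distance drops from [a.+1] to [a]. *)
have <- : b.+1 = m by lia.
rewrite modnn subn0 modnDr modn_small; last lia.
move: ab_gt0; have <- : b.+1 = m by lia.
have -> : (a + b.+1 - b = a.+1)%N by lia.
by rewrite modnS; case: ifP => // _ _; rewrite modn_small; lia.
Qed.

Lemma torus_dist_leq d m (x u : torus d m) : (torus_dist x u <= d * m)%N.
Proof.
rewrite -{2}(card_ord d) -sum_nat_const; apply: leq_sum => i _.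
by apply/ltnW; rewrite ltn_mod; have := ltn_ord (x i); lia.
Qed.

(** Advancing a coordinate that differs from that of [x] lowers [torus_dist]. *)
Lemma torus_ball d m (x u : torus d m) k :
  (torus_dist x u <= k)%N -> ball (@torus_adj d m) x k u.
Proof.
elim: k u => [|k IHk] u /= le_k.
  apply/eqP/ffunP => i; apply: val_inj => /=.
  apply: (cycle_dist0 (ltn_ord (x i)) (ltn_ord (u i))).
  apply/eqP; rewrite -leqn0; apply: leq_trans le_k.
  by rewrite /torus_dist (bigD1 i) //= leq_addr.
apply/orP; have [le_k'|lt_k] := leqP (torus_dist x u) k; first by left; apply: IHk.
right.
have [i xui] : exists i, (0 < (x i + m - u i) %% m)%N.
  apply/existsP; apply: contraTT lt_k => /existsPn x_u.
  by rewrite -leqNgt /torus_dist big1 // => i _; apply/eqP; rewrite -leqn0 leqNgt x_u.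
apply/existsP; exists (coord_move u (@ordS m) i); apply/andP; split; last first.
  apply/existsP; exists i; rewrite ffunE eqxx /cycle_adj eqxx /=.
  by apply/forallP => j; apply/implyP => /negPf ji; rewrite ffunE ji.
apply: IHk; rewrite -ltnS; apply: leq_trans le_k.
rewrite /torus_dist (bigD1 i) // [ltnRHS](bigD1 i) //= ffunE eqxx.
rewrite (eq_bigr (fun j => (x j + m - u j) %% m)%N); last first.
  by move=> j /negPf ji; rewrite ffunE ji.
rewrite ltn_add2r.
exact: (cycle_distS (ltn_ord (x i)) (ltn_ord (u i)) xui).
Qed.

(** * The bound: number of phases times length of a phase *)

Theorem theorem3p15 (R : realType) (d : nat) (K : R) :
  (1 <= d)%N -> 1 <= K ->
  exists C : R, forall (m n : nat) (td : torus d m -> nat),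
    (3 <= m)%N -> n = #|torus d m| ->
    rotor_lengths (@torus_adj d m) td ->
    (kappa (@torus_adj d m) td)%:R <= K ->
    (edge_cover_time (@torus_adj d m) R td
       <= (C * n%:R `^ (1 + d%:R^-1))%:E)%E.
Proof.
move=> d_gt0 K_ge1; pose L := (Num.truncn K)`!.
(* At most [2 * d * m] phases of at most [n * L * 2 * d] steps each. *)
exists (4 * d ^ 2 * L)%:R => m n td m_ge3 n_def td_ok kappaK.
have n_m : n = (m ^ d)%N by rewrite n_def card_ffun !card_ord.
(* The side length [m] is the [d]-th root of [n]. *)
have powE : n%:R `^ (1 + d%:R^-1) = (n * m)%:R :> R.
  have n_gt0 : (0 : R) < n%:R by rewrite ltr0n n_m expn_gt0; lia.
  rewrite powRD ?gt_eqF ?implybT // powRr1 ?ltW // natrM; congr (_ * _).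
  rewrite n_m natrX -powR_mulrn // -powRrM mulfV ?powRr1 //.
  by rewrite pnatr_eq0; lia.
have kappa_L u : (td u %/ deg (@torus_adj d m) u %| L)%N.
  have [td_gt0 deg_td] := td_ok u.
  apply: dvdn_fact; rewrite divn_gt0 ?(dvdn_gt0 td_gt0 deg_td) // dvdn_leq //=.
  rewrite truncn_ge_nat ?(le_trans ler01) //; apply: le_trans kappaK.
  by rewrite ler_nat; apply: leq_bigmax.
rewrite powE -natrM; apply: ge_ereal_sup => _ [s [p [x [s_ok p_ok ->]]]].
have covered : edges_traversed (@torus_adj d m) s p x
    ((d * m).+1 * \sum_u L * deg (@torus_adj d m) u).
  apply: (edges_traversed_ball (@torus_adj_sym d m) td_ok s_ok _ kappa_L p_ok).
    exact: fact_gt0.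
  by move=> u; apply/torus_ball/torus_dist_leq.
apply: (@le_trans _ _ ((d * m).+1 * \sum_u L * deg (@torus_adj d m) u)%:R%:E).
  by apply: ereal_inf_lbound; exists ((d * m).+1 * \sum_u L * deg (@torus_adj d m) u)%N.
rewrite lee_fin ler_nat.
have le_sum : (\sum_u L * deg (@torus_adj d m) u <= n * (L * (d * 2)))%N.
  rewrite n_def -sum_nat_const; apply: leq_sum => u _.
  by rewrite leq_mul2l deg_torus orbT.
(* Since [d * m] is positive, [(d * m).+1] is at most its double. *)
apply: (@leq_trans (2 * (d * m) * (n * (L * (d * 2))))); last by nia.
by apply: leq_mul => //; nia.
Qed.
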